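(* Let $U$ be an undirected graph, and for every $e\in E(U)$ let $(a_e,b_e,r_e,q_e)$ be a tuple of integers with $q_e\ge 2$ and $\gcd(a_e,q_e)=\gcd(b_e,q_e)=1$. Then there exists an integer $M$ such that the following holds. For every undirected graph $G$ and all sets $B_1,B_2\subseteq E(G)$ with $\mu^*(G,B_1,B_2)\ge M$, the graph $G$ contains a subdivision of $U$ such that for every $e\in E(U)$, the branching path $P_e$ of this subdivision corresponding to $e$ satisfies $$a_e\,|E(P_e)\cap B_1|+b_e\,|E(P_e)\cap B_2|\equiv r_e\pmod{q_e}.$$
   Context: All undirected graphs are finite and simple; $E(G)$ denotes the edge set of $G$. For an undirected graph $G$ and $B_1,B_2\subseteq E(G)$ (not necessarily disjoint), a cycle $C$ of $G$ is called $(B_1,B_2)$-unbalanced if $|E(C)\cap B_1|\neq|E(C)\cap B_2|$. $\mu^*(G,B_1,B_2)$ denotes the minimum number of parts in a partition $\mathcal{P}$ of $V(G)$ such that for every $P\in\mathcal{P}$ the subgraph $G[P]$ of $G$ induced by $P$ contains no $(B_1,B_2)$-unbalanced cycle. A subdivision of $U$ is a graph obtained from $U$ by replacing edges of $U$ by pairwise internally vertex-disjoint paths (with new internal vertices) joining the same endpoints; the branching path $P_e$ corresponding to an edge $e$ is the path replacing $e$ (or $e$ itself, viewed as a path of length 1, if it is not replaced). ''$G$ contains a subdivision of $U$'' means that some subgraph of $G$ is isomorphic to a subdivision of $U$. *)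

(* Defs.v *)
From mathcomp Require Import all_boot.

Set Implicit Arguments.
Unset Strict Implicit.
Unset Printing Implicit Defensive.

Record sgraph := SGraph {
  vertex :> finType;
  adj : rel vertex;
  adj_sym : symmetric adj;
  adj_irrefl : irreflexive adj
}.

(* An edge is an unordered pair of vertices, i.e. a two-element set. *)
Definition edges (G : sgraph) : {set {set G}} :=
  [set [set uv.1; uv.2] | uv : G * G & adj uv.1 uv.2].

Lemma edgesP (G : sgraph) (A : {set G}) :
  reflect (exists x y, adj x y /\ A = [set x; y]) (A \in edges G).
Proof.
apply: (iffP imsetP) => [[[x y]]|[x [y [xy ->]]]].
  by rewrite inE /= => xy ->; exists x, y.
by exists (x, y); rewrite ?inE.
Qed.

(* A cycle is given by the sequence of its vertices in cyclic order. The length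
   bound excludes the closed walks x, y, x, which are [ucycle]s of a symmetric
   relation. *)
Definition is_cycle (G : sgraph) (c : seq G) : bool :=
  (2 < size c) && ucycleb (@adj G) c.

Definition cycle_edges (G : sgraph) (c : seq G) : {set {set G}} :=
  [set [set x; next c x] | x in c].

Definition unbalanced (G : sgraph) (B1 B2 : {set {set G}}) (c : seq G) : bool :=
  #|cycle_edges c :&: B1| != #|cycle_edges c :&: B2|.

(* The cycles of the induced subgraph G[P] are the cycles of G all of whose
   vertices lie in P. Quantifying over tuples of length at most #|G| loses
   nothing, as the vertices of a cycle are distinct: see [no_unbalancedP]. *)
Definition no_unbalanced (G : sgraph) (B1 B2 : {set {set G}}) (P : {set G}) :
    bool :=
  [forall n : 'I_#|G|.+1, forall c : n.-tuple G,
    is_cycle c && all [in P] c ==> ~~ unbalanced B1 B2 c].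

Lemma no_unbalancedP (G : sgraph) (B1 B2 : {set {set G}}) (P : {set G}) :
  reflect (forall c : seq G, is_cycle c -> {subset c <= P} ->
             ~~ unbalanced B1 B2 c)
          (no_unbalanced B1 B2 P).
Proof.
apply: (iffP forallP) => [H c cC cP|H n].
  have szc : size c < #|G|.+1.
    by case/and3P: cC => _ _ /card_uniqP <-; rewrite ltnS max_card.
  have /forallP/(_ (in_tuple c))/implyP := H (Ordinal szc).
  by apply; rewrite /= cC; apply/allP.
apply/forallP => c; apply/implyP => /andP[cC /allP cP].
exact: H.
Qed.

Definition good_partition (G : sgraph) (B1 B2 : {set {set G}})
    (Q : {set {set G}}) : bool :=
  partition Q [set: G] && [forall P in Q, no_unbalanced B1 B2 P].

Lemma good_partition_ex (G : sgraph) (B1 B2 : {set {set G}}) :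
  exists n, [exists Q : {set {set G}}, good_partition B1 B2 Q && (#|Q| == n)].
Proof.
pose Q := preim_partition (fun x : G => x) [set: G].
exists #|Q|; apply/existsP; exists Q; rewrite eqxx andbT.
apply/andP; split; first exact: preim_partitionP.
apply/forall_inP => P /imsetP[x _ ->]; apply/no_unbalancedP.
move=> [|u [|v c]] // /and3P[_ _ /= /andP[]].
rewrite inE => /norP[/eqP uv _] _ sub; case: uv.
have := sub u; have := sub v; rewrite !inE !eqxx orbT /=.
by move=> /(_ isT)/eqP <- /(_ isT)/eqP <-.
Qed.

Definition mu_star (G : sgraph) (B1 B2 : {set {set G}}) : nat :=
  ex_minn (good_partition_ex B1 B2).

(* Paths are given by the full sequence of their vertices, ends included. *)

(* The two ends are compared as an unordered pair, since a path replacing an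
   undirected edge {u, v} may be listed from either end. *)
Definition is_path_joining (G : sgraph) (u v : G) (p : seq G) : bool :=
  if p is x :: s then
    [&& path (@adj G) x s, uniq p & [set x; last x s] == [set u; v]]
  else false.

Definition interior (T : Type) (p : seq T) : seq T :=
  if p is x :: s then behead (belast x s) else [::].

Definition path_edges (T : finType) (p : seq T) : {set {set T}} :=
  [set [set uv.1; uv.2] | uv in zip p (behead p)].

(* [subdivision U H]: a presentation of the graph H as a subdivision of U.
   [branch] locates the vertices of U in H and [bpath e] is the branching path
   of e; its values outside [edges U] are irrelevant. *)
Record subdivision (U H : sgraph) := Subdivision {
  branch : U -> H;
  bpath : {set U} -> seq H;
  branch_inj : injective branch;
  bpath_joins : forall x y : U, adj x y ->
    is_path_joining (branch x) (branch y) (bpath [set x; y]);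
  interior_new : forall e, e \in edges U ->
    forall x : U, branch x \notin interior (bpath e);
  interior_disjoint : forall e e', e \in edges U -> e' \in edges U -> e != e' ->
    [disjoint interior (bpath e) & interior (bpath e')];
  subdivision_vertices : forall v : H,
    (exists x : U, v = branch x) \/
    (exists2 e, e \in edges U & v \in interior (bpath e));
  subdivision_edges : edges H = \bigcup_(e in edges U) path_edges (bpath e)
}.

(* g is an isomorphism from H onto a (not necessarily induced) subgraph of G. *)
Definition subgraph_embedding (H G : sgraph) (g : H -> G) : Prop :=
  injective g /\ forall x y : H, adj x y -> adj (g x) (g y).

(* Main.v *)
Require Import Defs.
From mathcomp Require Import all_boot all_order all_algebra.
From mathcomp Require Import zify.

(* If the edges in exactly one of B1, B2 span a graph that is properly coloured
   with k colours, then its colour classes contain no unbalanced cycle. So a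
   large mu_star makes the graph with edge set B1 \ B2 (or B2 \ B1) have large
   chromatic number. On its edges the weight is the constant a (or b), a unit
   modulo q, and what remains is a theorem of Thomassen: large chromatic number
   forces subdivisions of U with branching path lengths prescribed modulo q.

   For that theorem, some breadth-first level L of a component still has large
   chromatic number, and any two of its vertices s, t are joined outside L by
   two disjoint tree paths of equal length d from a common ancestor. If s, t are
   adjacent, then the ancestor and s are joined by paths of lengths d and d + 1.
   Chaining k such pairs through nested levels joins any two vertices of the
   last level by paths of k + 1 consecutive lengths, hence of every length
   modulo q when k >= q - 1. Repeating this inside the last level provides one
   private zone of flexible paths for each edge of U. *)

Set Implicit Arguments.
Unset Strict Implicit.
Unset Printing Implicit Defensive.

Import GRing.Theory.

(** * Colourings of induced subgraphs *)

Section Colorable.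

Variables (T : finType) (e : rel T).

Definition colorable (k : nat) (V : {set T}) : bool :=
  [exists f : {ffun T -> 'I_k}, forall x in V, forall y in V,
    e x y ==> (f x != f y)].

Lemma colorableP (k : nat) (V : {set T}) :
  reflect (exists f : T -> 'I_k, {in V &, forall x y, e x y -> f x != f y})
          (colorable k V).
Proof.
apply: (iffP existsP) => [[f /'forall_in_forall_inP fP]|[f fP]].
  by exists f => x y xV yV; apply/implyP/fP.
exists [ffun x => f x]; apply/'forall_in_forall_inP => x xV y yV.
by apply/implyP; rewrite !ffunE; apply: fP.
Qed.

Lemma colorableS (k : nat) (V W : {set T}) :
  W \subset V -> colorable k V -> colorable k W.
Proof.
move=> /subsetP WV /colorableP[f fP]; apply/colorableP; exists f.
by move=> x y /WV xV /WV yV; apply: fP.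
Qed.

Lemma colorableU (k l : nat) (V W : {set T}) :
  colorable k V -> colorable l W -> colorable (k + l) (V :|: W).
Proof.
move=> /colorableP[f fP] /colorableP[g gP]; apply/colorableP.
exists (fun x => if x \in V then lshift l (f x) else rshift k (g x)).
move=> x y; rewrite !inE.
case: ifP => xV; case: ifP => yV //= xW yW exy.
- by rewrite (inj_eq (@lshift_inj _ _)); apply: fP.
- by rewrite eq_lrshift.
- by rewrite eq_rlshift.
- by rewrite (inj_eq (@rshift_inj _ _)); apply: gP.
Qed.

(** The colour of a vertex is its position in [enum V]. The inequality is strict because colourings
    are total on [T], and a vertex outside [V] gets the position [#|V|]. *)
Lemma card_colorable (k : nat) (V : {set T}) :
  irreflexive e -> #|V| < k -> colorable k V.
Proof.
move=> eI Vk; apply/colorableP.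
have ltk x : index x (enum V) < k.
  by apply: leq_ltn_trans Vk; rewrite cardE index_size.
exists (fun x => Ordinal (ltk x)) => x y xV yV exy.
apply: contraTneq exy => -[] /(congr1 (nth x (enum V))).
by rewrite !nth_index ?mem_enum // => ->; rewrite eI.
Qed.

Lemma uncolorable_edge (k : nat) (V : {set T}) :
  ~~ colorable k.+1 V -> exists x y, [/\ x \in V, y \in V & e x y].
Proof.
case: (boolP [exists x in V, exists y in V, e x y]).
  by move=> /exists_inP[x xV /exists_inP[y yV exy]] _; exists x, y.
move=> /exists_inPn noe /negP[]; apply/colorableP; exists (fun=> ord0).
by move=> x y /noe/exists_inPn/[apply]/negP.
Qed.

(** No edge leaves a class of [h], so colourings of the separate classes glue to a colouring of
    [V]. *)
Lemma uncolorable_class (k : nat) (V : {set T}) (h : T -> nat) :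
  {in V &, forall x y, e x y -> h x = h y} -> ~~ colorable k V ->
  exists i, ~~ colorable k [set x in V | h x == i].
Proof.
move=> hP; pose b := (\max_x h x).+1.
have hb x : h x < b by rewrite ltnS; apply: leq_bigmax.
case: (boolP [exists i : 'I_b, ~~ colorable k [set x in V | h x == i]]).
  by move=> /existsP[i iP]; exists (val i).
move=> /existsPn cP /negP[]; apply/colorableP.
have /fin_all_exists[f fP] (i : 'I_b) : exists f : T -> 'I_k,
    {in [set x in V | h x == i] &, forall x y, e x y -> f x != f y}.
  by apply/colorableP; move: (cP i); rewrite negbK.
exists (fun x => f (Ordinal (hb x)) x) => x y xV yV exy.
have -> : Ordinal (hb y) = Ordinal (hb x) by apply/val_inj; rewrite /= (hP x y).
by apply: fP; rewrite // inE ?xV ?yV /= ?(hP x y).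
Qed.

End Colorable.

(** * Breadth-first levels and tree paths *)

Lemma distance_from (T : finType) (e : rel T) (o : T) :
  exists d : T -> nat,
    [/\ forall x, connect e o x -> d x = 0 -> x = o,
        forall x y, connect e o x -> e x y -> d y <= (d x).+1 &
        forall x, connect e o x -> 0 < d x ->
          exists y, [/\ connect e o y, e y x & d x = (d y).+1]].
Proof.
pose P x n := [exists p : n.-tuple T, path e o p && (last o p == x)].
have PI p : path e o p -> P (last o p) (size p).
  by move=> op; apply/existsP; exists (in_tuple p); rewrite op eqxx.
(* [d x] is the least length of a walk from [o] to [x], with default 0 outside the component of
   [o]. *)
have /fin_all_exists[d dP] (x : T) : exists d, connect e o x ->
    P x d /\ forall n, P x n -> d <= n.
  case: (boolP (connect e o x)) => [/connectP[p op ->]|_]; last by exists 0.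
  have ex : exists n, P (last o p) n by exists (size p); apply: PI.
  by case: (ex_minnP ex) => n nP nmin; exists n.
have dle x y : connect e o x -> e x y -> d y <= (d x).+1.
  move=> ox exy; have [_] := dP y (connect_trans ox (connect1 exy)); apply.
  have [/existsP[p /andP[op /eqP lp]] _] := dP x ox.
  have := PI (rcons p y); rewrite rcons_path op lp exy last_rcons size_rcons.
  by rewrite size_tuple => /(_ isT).
exists d; split=> // x ox.
  have [+ _] := dP x ox => /[swap] ->.
  by move=> /existsP[p]; rewrite tuple0 => /eqP <-.
move=> dx0; have [/existsP[p /andP[op /eqP lp]] _] := dP x ox.
move: (size_tuple p) op lp; case: (lastP p) => [|s z] /=.
  by move=> d0; rewrite -d0 in dx0.
rewrite size_rcons rcons_path last_rcons => sz /andP[os esz] zx.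
rewrite {}zx in esz.
have oy : connect e o (last o s) by apply/connectP; exists s.
exists (last o s); split=> //; apply/eqP; rewrite eqn_leq dle //= -sz ltnS.
by have [_] := dP _ oy; apply; apply: PI.
Qed.

(* [m] lists the internal vertices of a path from [x] to [y]. *)
Definition link (T : eqType) (e : rel T) (x : T) (m : seq T) (y : T) : bool :=
  path e x (rcons m y) && uniq (x :: rcons m y).

Section Links.

Variables (T : finType) (e : rel T).

Lemma link_rcons (x y z : T) (m : seq T) :
  link e x m y -> e y z -> z \notin x :: rcons m y ->
  link e x (rcons m y) z.
Proof.
move=> /andP[xp xu] eyz zn; apply/andP; split.
  by rewrite rcons_path xp last_rcons.
by rewrite -rcons_cons rcons_uniq zn.
Qed.

Lemma link_cat (x y z : T) (m m' : seq T) :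
  link e x m y -> link e y m' z ->
  {in x :: m, forall v, v \notin rcons m' z} -> link e x (m ++ y :: m') z.
Proof.
move=> /andP[xp xu] /andP[yp yu] dis; apply/andP; split.
  by rewrite rcons_cat rcons_cons -cat_rcons cat_path xp last_rcons.
move: xu; rewrite -rcons_cons rcons_uniq => /andP[yxm xmu].
rewrite rcons_cat rcons_cons -cat_cons cat_uniq xmu yu andbT /=.
rewrite negb_or yxm; apply/hasPn => v vm'.
by apply: contraL vm' => /dis.
Qed.

Lemma link_rev (x y : T) (m : seq T) :
  symmetric e -> link e x m y -> link e y (rev m) x.
Proof.
move=> eS /andP[xp xu]; apply/andP.
have E : y :: rcons (rev m) x = rev (x :: rcons m y).
  by rewrite rev_cons rev_rcons.
split; last by rewrite E rev_uniq.
have := rev_path e x (rcons m y); rewrite last_rcons belast_rcons rev_cons => ->.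
by rewrite (eq_path (e' := e)) // => u v; rewrite eS.
Qed.

(** An edge changes the distance to the root by at most one, so distinct levels of the same parity
    are not adjacent. If all levels were [N]-colourable, [N] colours for each parity would colour
    the component. *)
Lemma bfs_level (N : nat) (V : {set T}) :
  symmetric e -> irreflexive e -> ~~ colorable e (N + N).+1 V ->
  exists L : {set T}, [/\ L \subset V, ~~ colorable e N L &
    {in L &, forall s t, s != t -> exists a m m',
      [/\ link e a m s, link e a m' t, size m = size m',
          {subset a :: m ++ m' <= V :\: L} & [disjoint m & m']]}].
Proof.
(* Restricting [e] to [V] keeps walks from a root in [V], hence all tree paths, inside [V]. *)
move=> eS eI ncV; pose r := [rel x y | [&& x \in V, y \in V & e x y]].
have rS : connect_sym r.
  by apply: sym_connect_sym => x y /=; rewrite eS andbCA.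
have := @uncolorable_class _ e _ V (fun x => enum_rank (fingraph.root r x)) _ ncV.
case=> [x y xV yV exy|i].
  have /eqP -> // : fingraph.root r x == fingraph.root r y.
  by rewrite root_connect // connect1 //= xV yV.
set C := [set x in V | _] => ncC.
have [C0|[o oC]] := set_0Vmem C.
  by rewrite C0 card_colorable ?cards0 in ncC.
have CV : C \subset V by apply/subsetP => x; rewrite inE => /andP[].
have oV := subsetP CV o oC.
have Co x : x \in C -> connect r o x.
  move: oC; rewrite !inE => /andP[_ /eqP <-] /andP[_ /eqP /val_inj/enum_rank_inj].
  by move/esym/eqP; rewrite root_connect.
have conV x : connect r o x -> x \in V.
  move=> /connectP[p]; case/lastP: p => [_ -> //|p z].
  by rewrite rcons_path last_rcons => /andP[_ /and3P[_ zV _]] ->.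
have [d [d0 dle dpar]] := distance_from r o.
(* Induction on the common depth: if the parents of [s] and [t] coincide, they are the ancestor
   sought; otherwise the two paths to the parents are extended by one vertex each. *)
have tree i' s t : connect r o s -> connect r o t -> d s = i' -> d t = i' ->
    s != t -> exists a m m',
    [/\ link e a m s, link e a m' t, size m = size m',
        {in a :: m ++ m', forall z, connect r o z /\ d z < i'} &
        [disjoint m & m']].
  elim: i' s t => [|n IH] s t os ot ds dt st.
    by rewrite (d0 s os ds) (d0 t ot dt) eqxx in st.
  have [|s' [os' /and3P[_ _ es'] ds']] := dpar s os; first by rewrite ds.
  have [|t' [ot' /and3P[_ _ et'] dt']] := dpar t ot; first by rewrite dt.
  have {}ds' : d s' = n by rewrite ds in ds'; case: ds'.
  have {}dt' : d t' = n by rewrite dt in dt'; case: dt'.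
  have far z w : d z = n.+1 -> d w <= n -> z != w.
    by move=> dz dw; apply: contraTneq dw => <-; rewrite dz ltnn.
  have [st'|st'] := eqVneq s' t'.
    exists s', [::], [::]; split=> //; last by rewrite disjoint_has.
    - by rewrite /link /= es' inE eq_sym far ?ds'.
    - by rewrite /link /= st' et' inE eq_sym far ?dt'.
    - by move=> z; rewrite mem_seq1 => /eqP ->; rewrite ds'.
  have [a [m [m' [lm lm' sz mP dis]]]] := IH s' t' os' ot' ds' dt' st'.
  have aP : connect r o a /\ d a < n by apply: mP; rewrite mem_head.
  have mPl z : z \in m -> connect r o z /\ d z < n.
    by move=> zm; apply: mP; rewrite inE mem_cat zm orbT.
  have mPr z : z \in m' -> connect r o z /\ d z < n.
    by move=> zm; apply: mP; rewrite inE mem_cat zm !orbT.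
  exists a, (rcons m s'), (rcons m' t'); split.
  - apply: link_rcons => //; rewrite inE mem_rcons inE !negb_or.
    rewrite !far ?ds' //=; last by apply: ltnW; case: aP.
    by apply/negP => /mPl[_]; rewrite ds ltnNge leqnSn.
  - apply: link_rcons => //; rewrite inE mem_rcons inE !negb_or.
    rewrite !far ?dt' //=; last by apply: ltnW; case: aP.
    by apply/negP => /mPr[_]; rewrite dt ltnNge leqnSn.
  - by rewrite !size_rcons sz.
  - move=> z; rewrite inE mem_cat !mem_rcons !inE.
    case/or4P=> [/eqP->|/orP[/eqP->|/mPl[]]|/eqP->|/mPr[]] //.
    + by case: aP => ? /ltnW.
    + by rewrite ds'.
    + by move=> ? /ltnW.
    + by rewrite dt'.
    + by move=> ? /ltnW.
  - rewrite disjoint_has; apply/hasPn => z; rewrite mem_rcons inE.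
    rewrite mem_rcons inE negb_or => /orP[/eqP->|zm].
      by rewrite st' /=; apply/negP => /mPr[_]; rewrite ds' ltnn.
    rewrite (disjointFr dis zm) andbT; apply: contraTneq zm => ->.
    by apply/negP => /mPl[_]; rewrite dt' ltnn.
pose E b := [set x in C | odd (d x) == b].
have dE b x y : x \in E b -> y \in E b -> e x y -> d x = d y.
  rewrite inE => /andP[xC /eqP ox]; rewrite inE => /andP[yC /eqP oy] exy.
  have := dle x y (Co _ xC); have := dle y x (Co _ yC).
  rewrite /= !(subsetP CV) // exy eS exy => /(_ isT) ? /(_ isT) ?; lia.
have [b ncE] : exists b, ~~ colorable e N (E b).
  have [cE|] := boolP (colorable e N (E true)); last by exists true.
  exists false; apply: contra ncC => cE'.
  have := colorableU cE cE'; rewrite -addn1.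
  (* The empty set takes up the spare colour, which is there so that the empty class is colourable
     even for [N = 0]. *)
  move=> cC; have := @colorableU _ e _ 1 _ set0 cC _.
  rewrite setU0 card_colorable ?cards0 // => /(_ isT).
  apply: colorableS; apply/subsetP => x xC.
  by rewrite inE [x \in E _]inE [x \in E false]inE xC /=; case: odd.
have [n ncL] := uncolorable_class (@dE b) ncE.
exists [set x in E b | d x == n]; split=> //.
  apply: subset_trans CV; apply/subsetP => x; rewrite inE => /andP[+ _].
  by rewrite inE => /andP[].
have oE z : z \in E b -> connect r o z by rewrite inE => /andP[/Co].
move=> s t /setIdP[/oE os /eqP ds] /setIdP[/oE ot /eqP dt] st.
have [a [m [m' [lm lm' sz mP dis]]]] := tree n s t os ot ds dt st.
exists a, m, m'; split=> // z /mP[/conV zV dz].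
rewrite inE zV andbT.
by apply/negP => /setIdP[_ /eqP dzn]; rewrite dzn ltnn in dz.
Qed.

End Links.

(** * Paths of consecutive lengths *)

(** Induction on [j] along nested sets [L3], [L2], [W1], [V]. A path runs from [x] to [a] through
    [V :\: W1] with [j + 1] consecutive lengths available, from [a] to [s] through [W1 :\: L2] and
    possibly [t] with two consecutive lengths, and from [s] to [y] through [L2 :\: L3]. The sums
    cover [j + 2] consecutive lengths. *)
Lemma flexible_paths (j N : nat) : exists K : nat,
  forall (T : finType) (e : rel T) (V : {set T}),
    symmetric e -> irreflexive e -> ~~ colorable e K V ->
  exists W : {set T}, [/\ W \subset V, ~~ colorable e N W &
    {in W &, forall x y, x != y -> exists c : nat, forall i, i <= j ->
      exists m, [/\ link e x m y, size m = c + i &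
                    {subset m <= V :\: W}]}].
Proof.
(* One path of uncontrolled length: up one tree path to the common ancestor and down the other. *)
have base M (T : finType) (e : rel T) (V : {set T}) :
    symmetric e -> irreflexive e -> ~~ colorable e (M + M).+1 V ->
  exists W : {set T}, [/\ W \subset V, ~~ colorable e M W &
    {in W &, forall x y, x != y ->
      exists2 m, link e x m y & {subset m <= V :\: W}}].
  move=> eS eI /(bfs_level eS eI)[W [WV ncW WP]].
  exists W; split=> // x y xW yW xy.
  have [a [m [m' [lm lm' sz mP dis]]]] := WP x y xW yW xy.
  exists (rev m ++ a :: m'); last first.
    by move=> z zm; apply: mP; move: zm; rewrite !inE !mem_cat mem_rev inE orbCA.
  apply: (link_cat _ lm' _); first exact: link_rev.
  move=> z; rewrite inE mem_rev mem_rcons inE negb_or => /orP[/eqP->|zm].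
    rewrite xy /=; apply/negP => xm'.
    by have := mP x; rewrite !inE mem_cat xm' xW !orbT => /(_ isT).
  rewrite (disjointFr dis zm) andbT; apply: contraTneq zm => ->; apply/negP => ym.
  by have := mP y; rewrite !inE mem_cat ym yW !orbT => /(_ isT).
elim: j => [|j IH] in N *.
  exists (N + N).+1 => T e V eS eI /(base _ _ _ _ eS eI)[W [WV ncW WP]].
  exists W; split=> // x y xW yW /(WP x y xW yW)[m lm mP].
  by exists (size m) => i; rewrite leqn0 => /eqP ->; exists m; rewrite addn0.
(* [L3] must resist [N + 3] colours because deleting [s] and [t] may cost 3, by the strict bound in
   [card_colorable]. Each breadth-first step doubles the number of colours and adds one. *)
pose N3 := (N + 3 + (N + 3)).+1; pose N2 := (N3 + N3).+1.
have [K KP] := IH N2.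
exists K => T e V eS eI /(KP _ _ _ eS eI)[W1 [W1V ncW1 W1P]].
have [L2 [L2W1 ncL2 L2P]] := bfs_level eS eI ncW1.
have [L3 [L3L2 ncL3 L3P]] := base _ _ _ _ eS eI ncL2.
have [s [t [sL3 tL3 est]]] : exists s t, [/\ s \in L3, t \in L3 & e s t].
  by apply: (@uncolorable_edge _ _ (N + 2)); rewrite -addnS.
have st : s != t by apply: contraTneq est => ->; rewrite eI.
have sL2 := subsetP L3L2 s sL3; have tL2 := subsetP L3L2 t tL3.
have [a [m [m' [lm lm' sz mP dis]]]] := L2P s t sL2 tL2 st.
have aW1L2 : a \in W1 :\: L2 by apply: mP; rewrite mem_head.
have mPl z : z \in m -> z \in W1 :\: L2.
  by move=> zm; apply: mP; rewrite inE mem_cat zm orbT.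
have mPr z : z \in m' -> z \in W1 :\: L2.
  by move=> zm; apply: mP; rewrite inE mem_cat zm !orbT.
have [aW1 aL2] := setDP aW1L2.
(* The longer route follows the other tree path to [t], then the edge from [t] to [s]. *)
have lst : link e a (rcons m' t) s.
  apply: (link_rcons lm' _ _); first by rewrite eS.
  rewrite inE mem_rcons inE !negb_or st (memPn aL2) //=.
  by apply/negP => /mPr/setDP[_]; rewrite sL2.
have digon i : i <= 1 -> exists2 p, link e a p s & size p = size m + i /\
    {subset p <= t |: (W1 :\: L2)}.
  case: i => [_|[_|//]].
    by exists m => //; rewrite addn0; split=> // z /mPl zW; rewrite inE zW orbT.
  exists (rcons m' t); rewrite // size_rcons sz addn1; split=> // z.
  by rewrite mem_rcons !inE => /orP[->//|/mPr]; rewrite inE => ->; rewrite orbT.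
(* [s] and [t] become internal vertices, so they must leave the final set. *)
exists (L3 :\: [set s; t]); split.
- apply: subset_trans W1V; apply: subset_trans L2W1; apply: subset_trans L3L2.
  exact: subsetDl.
- apply: contra ncL3 => cW.
  have cst : colorable e 3 [set s; t].
    by apply: card_colorable; rewrite // cards2; case: (s != t).
  apply: colorableS (colorableU cW cst).
  by apply/subsetP => z zL3; rewrite !inE zL3 andbT orNb.
move=> x y /setDP[xL3 xst] /setDP[yL3 yst] xy.
have xL2 := subsetP L3L2 x xL3; have xW1 := subsetP L2W1 x xL2.
have yL2 := subsetP L3L2 y yL3; have yW1 := subsetP L2W1 y yL2.
have [|c cP] := W1P x a xW1 aW1; first exact: (memPn aL2).
have [|p3 lp3 p3P] := L3P s y sL3 yL3.
  by apply: contraNneq yst => <-; rewrite !inE eqxx.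
(* Sizes count internal vertices; the two successors account for the junctions [a] and [s]. *)
exists (c + (size m).+1 + (size p3).+1) => i ij.
have [i1 [i2 [i1j i21 ->]]] : exists i1 i2, [/\ i1 <= j, i2 <= 1 & i = i1 + i2].
  have [iltj|jlti] := leqP i j; first by exists i, 0; rewrite addn0.
  by exists j, 1; split=> //; rewrite addn1; apply/eqP; rewrite eqn_leq ij.
have [p1 [lp1 sp1 p1P]] := cP i1 i1j.
have [p2 lp2 [sp2 p2P]] := digon i2 i21.
have notW z : z \notin L3 -> z \notin L3 :\: [set s; t].
  by apply: contra => /setDP[].
have p1V z : z \in p1 -> (z \in V) * (z \notin W1) by move=> /p1P/setDP[].
have p2V z : z \in p2 -> z = t \/ z \in W1 :\: L2.
  by move=> /p2P/setU1P.
have p3V z : z \in p3 -> (z \in L2) * (z \notin L3) by move=> /p3P/setDP[].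
exists (p1 ++ a :: p2 ++ s :: p3); split.
- apply: (link_cat lp1 _ _).
    apply: (link_cat lp2 lp3 _) => z za; rewrite mem_rcons inE negb_or.
    have [->|zW] : z = t \/ z \in W1 :\: L2.
      by move: za; rewrite inE => /orP[/eqP->|/p2V //]; right.
      rewrite (contraNneq _ yst) => [|<-]; last by rewrite !inE eqxx orbT.
      by apply/negP => /p3V; rewrite tL3 => -[].
    have [_ zL2] := setDP zW; rewrite (memPnC zL2) //=.
    by apply/negP => /p3V[]; rewrite (negPf zL2).
  (* The part after [a] stays in [W1], so it misses [p1]; it meets [L3] at most in [y], [s], [t], so
     it misses [x]. *)
  have tail z : z \in rcons (p2 ++ s :: p3) y ->
      z \in W1 /\ (z \in L3 -> z \in [set y; s; t]).
    rewrite mem_rcons inE mem_cat inE.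
    case/or4P=> [/eqP->|/p2V[->|/setDP[-> /negP zL2]]|/eqP->|/p3V[zL2 /negP zL3]].
    + by rewrite !inE eqxx yW1.
    + by rewrite (subsetP L2W1) // !inE eqxx !orbT.
    + by split=> // /(subsetP L3L2).
    + by rewrite (subsetP L2W1) // !inE eqxx !orbT.
    + by rewrite (subsetP L2W1).
  move=> z; rewrite inE => /orP[/eqP->|/p1V[_ zW1]]; apply/negP => /tail[].
    move=> _ /(_ xL3); rewrite !inE -orbA (negPf xy) /=.
    by move: xst; rewrite !inE => /negPf ->.
  by rewrite (negPf zW1).
- rewrite size_cat /= size_cat /= sp1 sp2.
  by move: (size m) (size p3) => u v; clear; lia.
have W3 z : z \in W1 ->
    z \notin L3 :\: [set s; t] -> z \in V :\: (L3 :\: [set s; t]).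
  by move=> zW1 zW; rewrite in_setD zW (subsetP W1V).
have notL2 z : z \in W1 :\: L2 -> z \in V :\: (L3 :\: [set s; t]).
  case/setDP=> zW1 zL2; apply/W3/notW => //.
  by apply: contra zL2; apply: subsetP.
move=> z; rewrite mem_cat inE mem_cat inE.
case/or4P=> [/p1V[zV zW1]|/eqP->|/p2V[->|]|/orP[/eqP->|/p3V[zL2 zL3]]].
- rewrite in_setD zV andbT; apply/notW; apply: contra zW1 => zL3.
  exact/(subsetP L2W1)/(subsetP L3L2).
- exact: notL2.
- by apply: W3; rewrite ?(subsetP L2W1) // !inE eqxx orbT.
- exact: notL2.
- by apply: W3; rewrite ?(subsetP L2W1) // !inE eqxx.
- by apply: W3 (notW z zL3); apply: (subsetP L2W1).
Qed.

(** Each index peels off one layer: the zone of [i0] is [V :\: V'], and the remaining indices are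
    served inside [V']. As the zones are disjoint from each other and from [W], paths for different
    indices can share only their ends. *)
Lemma flexible_linkages (n j : nat) (I : eqType) (s : seq I) : exists K : nat,
  forall (T : finType) (e : rel T) (V : {set T}),
    symmetric e -> irreflexive e -> ~~ colorable e K V ->
  exists (W : {set T}) (Z : I -> {set T}),
    [/\ W \subset V, n <= #|W|,
        {in s, forall i, Z i \subset V :\: W},
        {in s &, forall i i', i != i' -> [disjoint Z i & Z i']} &
        {in W &, forall x y, x != y -> {in s, forall i,
          exists c : nat, forall k, k <= j ->
          exists m, [/\ link e x m y, size m = c + k &
                        {subset m <= Z i}]}}].
Proof.
elim: s => [|i0 s [K KP]].
  exists n => T e V eS eI ncV; exists V, (fun=> set0); split=> //.
  by rewrite leqNgt; apply: contra ncV; apply: card_colorable.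
have [K' K'P] := flexible_paths j K.
exists K' => T e V eS eI /(K'P _ _ _ eS eI)[V' [V'V ncV' V'P]].
have [W [Z [WV' nW ZV' Zdis ZP]]] := KP T e V' eS eI ncV'.
exists W, (fun i => if i == i0 then V :\: V' else Z i); split=> //.
- exact: subset_trans WV' V'V.
- move=> i; rewrite inE; case: eqP => [_ _|_ /= /ZV' iZ]; first exact: setDS.
  by apply: subset_trans iZ _; apply: setSD.
- have ZV'0 i : i \in s -> [disjoint Z i & V :\: V'].
    move=> /ZV' iZ; rewrite -setI_eq0 -subset0; apply/subsetP => z.
    by rewrite !inE => /andP[/(subsetP iZ)]; rewrite inE => /andP[_ ->].
  move=> i i'; rewrite !inE.
  case: eqP => [->|_]; case: eqP => [->|_] //=; rewrite ?eqxx //.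
  + by move=> _ /ZV'0; rewrite disjoint_sym.
  + by move=> /ZV'0.
  + exact: Zdis.
- move=> x y xW yW xy i; rewrite inE; case: eqP => [_ _|_ /=]; last exact: ZP.
  exact: V'P (subsetP WV' _ xW) (subsetP WV' _ yW) xy.
Qed.

(** * Edge sets of paths and assembly of a subdivision *)

Section PathEdges.

Variable T : finType.

Lemma set2_eq (a b c d : T) :
  [set a; b] = [set c; d] -> (a = c /\ b = d) \/ (a = d /\ b = c).
Proof.
move=> E; have := set21 a b; have := set22 a b; have := set21 c d.
have := set22 c d; rewrite {1 2}E -{1 2}E !inE.
do 4!(case/orP => /eqP ?); subst; tauto.
Qed.

Lemma path_edges_cons (x y : T) (s : seq T) :
  path_edges [:: x, y & s] = [set x; y] |: path_edges (y :: s).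
Proof.
apply/setP => A; rewrite !inE; apply/imsetP/orP => /=.
  move=> [uv]; rewrite inE => /orP[/eqP-> ->|uvs ->]; [by left|right].
  exact: imset_f.
case=> [/eqP->|/imsetP[uv uvs ->]]; first by exists (x, y); rewrite ?mem_head.
by exists uv; rewrite // inE uvs orbT.
Qed.

Lemma path_edges1 (x : T) : path_edges [:: x] = set0.
Proof. by apply/setP => A; rewrite inE; apply/imsetP => -[]. Qed.

(** Ensures that a branching path remains a path in a graph having only the edges of the branching
    paths. *)
Lemma path_path_edges (x : T) (s : seq T) :
  path (fun u v => [set u; v] \in path_edges (x :: s)) x s.
Proof.
elim: s x => [|y s IH] x //=; rewrite path_edges_cons setU11 /=.
by apply: sub_path (IH y) => u v uv; apply: setU1r.
Qed.

Lemma path_edges_sub (p : seq T) (A : {set T}) :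
  A \in path_edges p -> {subset A <= p}.
Proof.
case: p => [|x s]; first by move=> /imsetP[].
elim: s x => [|y s IH] x; first by rewrite path_edges1 inE.
rewrite path_edges_cons => /setU1P[->|/IH sub] z; last first.
  by move=> /sub; rewrite [z \in x :: _]inE orbC => ->.
by move=> /set2P[]->; rewrite !inE eqxx ?orbT.
Qed.

Lemma card_path_edges (x : T) (s : seq T) :
  uniq (x :: s) -> #|path_edges (x :: s)| = size s.
Proof.
elim: s x => [|y s IH] x; first by rewrite path_edges1 cards0.
rewrite cons_uniq => /andP[xs ys]; rewrite path_edges_cons cardsU1 IH //.
suff -> : [set x; y] \notin path_edges (y :: s) by [].
by apply: contra xs => /path_edges_sub; apply; rewrite set21.
Qed.

Lemma path_edgesP (e : rel T) (x : T) (s : seq T) (A : {set T}) :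
  path e x s -> A \in path_edges (x :: s) ->
  exists y z, e y z /\ A = [set y; z].
Proof.
elim: s x => [|y s IH] x; first by rewrite path_edges1 inE.
rewrite path_edges_cons /= => /andP[exy ys] /setU1P[->|]; last exact: IH.
by exists x, y.
Qed.

End PathEdges.

Lemma path_edges_map (T T' : finType) (f : T' -> T) (p : seq T') :
  path_edges (map f p) = [set f @: A | A : {set T'} in path_edges p].
Proof.
case: p => [|x s].
  by apply/setP => A; apply/imsetP/imsetP => -[? //] /imsetP[].
elim: s x => [|y s IH] x /=; first by rewrite !path_edges1 imset0.
by rewrite !path_edges_cons imsetU1 -IH imsetU1 imset_set1.
Qed.

Lemma interior_map (T T' : Type) (f : T' -> T) (p : seq T') :
  interior (map f p) = map f (interior p).
Proof. by case: p => [|x [|y s]] //=; elim: s y => //= z s IH y; rewrite IH. Qed.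

Lemma mem_interior (T : eqType) (p : seq T) (x z : T) :
  z \in x :: p -> [|| z == x, z == last x p | z \in interior (x :: p)].
Proof.
case: p => [|y p] /=; first by rewrite inE => ->.
rewrite inE => /predU1P[->|]; first by rewrite eqxx.
by rewrite lastI mem_rcons inE => ->; rewrite orbT.
Qed.

(** [H] is the union of the given paths and branch vertices, taken as a graph on its own vertex
    type; [g] is the inclusion into [G]. *)
Lemma subdivision_of_paths (U G : sgraph) (br : U -> G)
    (p : {set U} -> seq G) :
  injective br ->
  (forall x y : U, adj x y -> is_path_joining (br x) (br y) (p [set x; y])) ->
  (forall e, e \in edges U -> forall x, br x \notin interior (p e)) ->
  (forall e e', e \in edges U -> e' \in edges U -> e != e' ->
     [disjoint interior (p e) & interior (p e')]) ->
  exists (H : sgraph) (S : subdivision U H) (g : H -> G),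
    subgraph_embedding g /\
    forall e, e \in edges U -> map g (bpath S e) = p e.
Proof.
move=> brI pJ pbr pdis.
pose X := [set z | (z \in codom br) ||
  [exists e in edges U, z \in interior (p e)]].
have pX e : e \in edges U -> {subset p e <= X}.
  move=> eU; have /edgesP[x [y [xy exy]]] := eU.
  have := pJ x y xy; rewrite -exy; case E : (p e) => [|v s] //= /and3P[_ _ /eqP vs].
  move=> z /mem_interior/or3P[/eqP->|/eqP->|zs].
  + have : v \in [set br x; br y] by rewrite -vs set21.
    by rewrite !inE => /orP[]/eqP->; rewrite codom_f.
  + have : last v s \in [set br x; br y] by rewrite -vs set22.
    by rewrite !inE => /orP[]/eqP->; rewrite codom_f.
  + rewrite inE; apply/orP; right; apply/exists_inP; exists e => //.
    by rewrite E.
pose H0 : finType := {z : G | z \in X}.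
pose a0 := [rel u v : H0 |
  [exists e in edges U, [set val u; val v] \in path_edges (p e)]].
have a0G (u v : H0) : a0 u v -> adj (val u) (val v).
  move=> /exists_inP[e eU]; have /edgesP[x [y [xy exy]]] := eU.
  have := pJ x y xy; rewrite -exy; case: (p e) => [|w s] //= /and3P[ws _ _].
  move=> /(path_edgesP ws)[y1 [z1 [yz /set2_eq[[-> ->] //|[-> ->]]]]].
  by rewrite adj_sym.
have a0S : symmetric a0 by move=> u v; rewrite /= setUC.
have a0I : irreflexive a0.
  by move=> u; apply/negbTE/negP => /a0G; rewrite adj_irrefl.
pose H := SGraph a0S a0I.
have brX x : br x \in X by rewrite inE codom_f.
pose hbr x : H := Sub (br x) (brX x).
(* [pmap insub] would drop vertices outside [X]; by [pX] a branching path has none, so [val]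
   recovers [p e]. *)
pose bp e : seq H := pmap insub (p e).
have bpE e : e \in edges U -> map val (bp e) = p e.
  move=> eU; rewrite /bp (pmap_filter (insubK _)); apply/all_filterP/allP => z zp.
  by rewrite insubT //; apply: (pX e).
have valI : injective (val : H -> G) by apply: val_inj.
have bint e z : e \in edges U ->
    (z \in interior (bp e)) = (val z \in interior (p e)).
  by move=> eU; rewrite -(bpE e) // interior_map (mem_map valI).
have bedge e (u v : H) : e \in edges U ->
    ([set u; v] \in path_edges (bp e)) = ([set val u; val v] \in path_edges (p e)).
  move=> eU; rewrite -(bpE e) // path_edges_map.
  have -> : [set val u; val v] = val @: [set u; v] by rewrite imsetU1 imset_set1.
  by rewrite (mem_imset _ _ (imset_inj valI)).
have bpJ x y : adj x y -> is_path_joining (hbr x) (hbr y) (bp [set x; y]).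
  move=> xy; have eU : [set x; y] \in edges U by apply/edgesP; exists x, y.
  have := pJ x y xy; rewrite -(bpE _ eU).
  case E : (bp _) => [|w s] //=; rewrite last_map => /and3P[_ us /eqP ends].
  apply/and3P; split; last 1 first.
  - by apply/eqP/(imset_inj valI); rewrite !imsetU1 !imset_set1 /= ends.
  - apply: sub_path (path_path_edges w s) => u v /=; rewrite -E bedge // => uv.
    by apply/exists_inP; exists [set x; y].
  - by move: us; rewrite (mem_map valI) (map_inj_uniq valI).
unshelve refine (let S := @Subdivision U H hbr bp _ bpJ _ _ _ _ in _).
- by move=> x y /(congr1 val) /brI.
- move=> e eU x; rewrite bint //; exact: pbr.
- move=> e e' eU eU' ee'; rewrite disjoint_has; apply/hasPn => z.
  by rewrite !bint // => ze; rewrite (disjointFr (pdis e e' eU eU' ee') ze).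
- move=> z; have := valP z; rewrite inE => /orP[/codomP[x xz]|/exists_inP[e eU ze]].
    by left; exists x; apply: val_inj.
  by right; exists e; rewrite // bint.
- apply/setP => A; apply/edgesP/bigcupP.
    move=> [u [v [/exists_inP[e eU uve] ->]]]; exists e => //.
    by rewrite bedge.
  move=> [e eU Ae]; have /edgesP[x [y [xy exy]]] := eU.
  have := bpJ x y xy; rewrite -exy; move: Ae; case: (bp e) => [|w s].
    by move=> /imsetP[].
  by move=> Ae /and3P[ws _ _]; apply: path_edgesP ws Ae.
by exists H, S, val; split; first split.
Qed.

(** * Prescribing residues of path lengths *)

Lemma affine_mod_solvable (a q r : int) (c : nat) :
  (2 <= q)%R -> gcdz a q = 1%R ->
  exists2 k : nat, k <= `|q|%N & (a * (c + k)%:Z = r %[mod q])%Z.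
Proof.
move=> q2 aq; have [u [v uv]] := Bezoutz a q; rewrite aq in uv.
have q0 : q != 0%R by lia.
(* [u] inverts [a] modulo [q], so the residue of [u * r - c] is the amount to add to [c]. *)
pose z := ((u * r - c%:Z) %% q)%Z.
have z0 : (0 <= z)%R by apply: modz_ge0.
have zq : (z < `|q|)%R by apply: ltz_mod.
exists `|z|%N; first by lia.
have -> : ((c + `|z|)%N%:Z = c%:Z + z)%R by lia.
rewrite /z -modzMmr modzDmr modzMmr.
have -> : (a * (c%:Z + (u * r - c%:Z)) = r + (- v * r) * q)%R.
  rewrite addrC subrK mulrA [(a * u)%R]mulrC.
  have -> : (u * a = 1 - v * q)%R by rewrite -uv addrK.
  by rewrite mulrBl mul1r !mulNr mulrAC.
by rewrite addrC modzMDl.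
Qed.

(** A path with all edges in [B :\: B'] has no edge in [B'] and all of them in [B], so the
    congruence just prescribes its length modulo [q e]. *)
Lemma subdivision_in_difference (U : sgraph) (a r q : {set U} -> int) :
  (forall e, e \in edges U -> (2 <= q e)%R) ->
  (forall e, e \in edges U -> gcdz (a e) (q e) = 1%R) ->
  exists K : nat, forall (G : sgraph) (B B' : {set {set G}}),
    B \subset edges G ->
    ~~ colorable [rel x y : G | [set x; y] \in B :\: B'] K [set: G] ->
  exists (H : sgraph) (S : subdivision U H) (g : H -> G),
    subgraph_embedding g /\
    forall e, e \in edges U ->
      #|path_edges (map g (bpath S e)) :&: B'| = 0 /\
      (a e * #|path_edges (map g (bpath S e)) :&: B|%:Z = r e %[mod q e])%Z.
Proof.
(* One [j] for all edges: [affine_mod_solvable] asks for at most the absolute value of [q e] as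
   extra length. *)
move=> hq ha; pose j := \max_e `|q e|%N.
have [K KP] := flexible_linkages #|U| j (enum (edges U)).
exists K => G B B' BG; set e1 := [rel x y : G | _] => ncG.
have e1adj (x y : G) : e1 x y -> adj x y.
  move=> /setDP[/(subsetP BG)/edgesP[u [v [uv E]]] _].
  by case: (set2_eq E) => -[-> ->] //; rewrite adj_sym.
have e1S : symmetric e1 by move=> x y; rewrite /= setUC.
have e1I : irreflexive e1.
  by move=> x; apply/negbTE/negP => /e1adj; rewrite adj_irrefl.
have [W [Z [_ UW ZW Zdis ZP]]] := KP _ _ _ e1S e1I ncG.
pose br x : G := enum_val (widen_ord UW (enum_rank x)).
have brI : injective br.
  by move=> x y /enum_val_inj/(congr1 val)/= /val_inj/enum_rank_inj.
have brW x : br x \in W by apply: enum_valP.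
(* The path is built for one ordering of the ends of [e] but has to serve both, hence the
   quantification over [x] and [y]. *)
have /fin_all_exists[p pP] (e : {set U}) : exists p : seq G, e \in edges U ->
    [/\ forall x y, adj x y -> e = [set x; y] ->
          is_path_joining (br x) (br y) p,
        {subset interior p <= Z e},
        #|path_edges p :&: B'| = 0 &
        (a e * #|path_edges p :&: B|%:Z = r e %[mod q e])%Z].
  have [eU|_] := boolP (e \in edges U); last by exists [::].
  have /edgesP[x [y [xy exy]]] := eU.
  have xy' : br x != br y.
    by rewrite (inj_eq brI); apply: contraTneq xy => ->; rewrite adj_irrefl.
  have es : e \in enum (edges U) by rewrite mem_enum.
  have [c cP] := ZP _ _ (brW x) (brW y) xy' e es.
  (* The successor appears because a path has one edge more than internal vertices. *)
  have [k kq kP] := affine_mod_solvable (r e) c.+1 (hq e eU) (ha e eU).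
  have [|m [/andP[mp mu] sm mZ]] := cP k.
    by apply: leq_trans kq _; apply: (leq_bigmax e).
  exists (br x :: rcons m (br y)) => _.
  have mB A : A \in path_edges (br x :: rcons m (br y)) -> A \in B :\: B'.
    by move=> /(path_edgesP mp)[u [v [uv ->]]].
  split.
  - move=> x' y' _ exy'; apply/and3P; split=> //.
      by apply: sub_path mp => u v; apply: e1adj.
    rewrite last_rcons; have := congr1 (fun A : {set U} => br @: A) exy'.
    by rewrite exy !imsetU1 !imset_set1 => ->.
  - by move=> z; rewrite /= belast_rcons => /mZ.
  - apply/eqP; rewrite cards_eq0 setI_eq0 disjoint_subset; apply/subsetP => A.
    by move=> /mB /setDP[].
  - rewrite (setIidPl _) ?card_path_edges //; last first.
      by apply/subsetP => A /mB/setDP[].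
    by rewrite size_rcons sm -addSn.
have [||| H [S [g [gE gp]]]] := @subdivision_of_paths U G br p brI.
- move=> x y xy; have eU : [set x; y] \in edges U by apply/edgesP; exists x, y.
  by have [+ _ _ _] := pP _ eU; apply.
- move=> e eU x; have [_ pZ _ _] := pP e eU; apply/negP => /pZ xZ.
  have /ZW/subsetP/(_ _ xZ) : e \in enum (edges U) by rewrite mem_enum.
  by rewrite !inE brW.
- move=> e e' eU e'U ee'; have [_ pZ _ _] := pP e eU.
  have [_ pZ' _ _] := pP e' e'U.
  have := Zdis e e'; rewrite !mem_enum => /(_ eU e'U ee') dis.
  rewrite disjoint_has; apply/hasPn => z /pZ zZ; apply/negP => /pZ'.
  by rewrite (disjointFr dis zZ).
exists H, S, g; split=> // e eU; rewrite gp //.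
by have [] := pP e eU.
Qed.

(** * From colourings to [mu_star] *)

(** Partition by pairs of colours. An edge inside a part lies in neither difference, hence in both
    sets or in none, so every cycle inside a part is balanced. *)
Lemma mu_star_colorable (G : sgraph) (B1 B2 : {set {set G}}) (k1 k2 : nat) :
  colorable [rel x y : G | [set x; y] \in B1 :\: B2] k1 [set: G] ->
  colorable [rel x y : G | [set x; y] \in B2 :\: B1] k2 [set: G] ->
  mu_star B1 B2 <= k1 * k2.
Proof.
move=> /colorableP[f fP] /colorableP[g gP]; pose h x := (f x, g x).
pose Q := preim_partition h [set: G].
have hE (P : {set G}) : P \in Q -> {in P &, forall x y, h x = h y}.
  by move=> /imsetP[z _ ->] x y; rewrite !inE /= => /eqP <- /eqP <-.
have QP : good_partition B1 B2 Q.
  apply/andP; split; first exact: preim_partitionP.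
  apply/forall_inP => P PQ; apply/no_unbalancedP => c /andP[_ _] cP.
  suff BE A : A \in cycle_edges c -> (A \in B1) = (A \in B2).
    rewrite negbK; apply/eqP; congr #|pred_of_set _|; apply/setP => A.
    by rewrite !inE; case: (boolP (A \in _)) => //= /BE.
  move=> /imsetP[x xc ->]; have ync : next c x \in c by rewrite mem_next.
  have [fE gE] := hE P PQ _ _ (cP _ xc) (cP _ ync).
  apply/idP/idP => xy; apply: contraT => nxy.
    have := fP x (next c x).
    by rewrite fE eqxx /= in_setD xy nxy !inE => /(_ isT isT isT).
  have := gP x (next c x).
  by rewrite gE eqxx /= in_setD xy nxy !inE => /(_ isT isT isT).
have cardQ : #|Q| <= k1 * k2.
  (* A part is determined by its pair of colours. *)
  have -> : Q = (fun i => [set y | i == h y]) @: (h @: [set: G]).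
    by rewrite -imset_comp; apply: eq_imset => x; apply/setP => y; rewrite !inE.
  apply: leq_trans (leq_imset_card _ _) _; apply: leq_trans (max_card _) _.
  by rewrite card_prod !card_ord.
rewrite /mu_star; case: ex_minnP => n _ nmin; apply: leq_trans cardQ.
by apply: nmin; apply/existsP; exists Q; rewrite QP eqxx.
Qed.

Theorem corollary4p6 (U : sgraph) (a b r q : {set U} -> int)
    (hq : forall e, e \in edges U -> (2 <= q e)%R)
    (ha : forall e, e \in edges U -> gcdz (a e) (q e) = 1%R)
    (hb : forall e, e \in edges U -> gcdz (b e) (q e) = 1%R) :
  exists M : nat,
    forall (G : sgraph) (B1 B2 : {set {set G}}),
      B1 \subset edges G -> B2 \subset edges G ->
      M <= mu_star B1 B2 ->
      exists (H : sgraph) (S : subdivision U H) (g : H -> G),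
        subgraph_embedding g /\
        forall e, e \in edges U ->
          let Pe := map g (bpath S e) in
          (a e * #|path_edges Pe :&: B1|%:Z + b e * #|path_edges Pe :&: B2|%:Z
             = r e %[mod q e])%Z.
Proof.
have [Ka KaP] := subdivision_in_difference r hq ha.
have [Kb KbP] := subdivision_in_difference r hq hb.
(* By [mu_star_colorable] one of the two differences is not colourable with its number of colours;
   the branching paths found there avoid the other set, so one term of the sum vanishes. *)
exists (Ka * Kb).+1 => G B1 B2 B1G B2G; rewrite leqNgt ltnS => mu.
case: (boolP (colorable [rel x y : G | [set x; y] \in B1 :\: B2] Ka [set: G])).
  move=> c1.
  have : ~~ colorable [rel x y : G | [set x; y] \in B2 :\: B1] Kb [set: G].
    by apply: contra mu => c2; apply: mu_star_colorable.
  move=> /(KbP _ _ _ B2G)[H [S [g [gE gP]]]].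
  exists H, S, g; split=> // e eU /=; have [-> <-] := gP e eU.
  by rewrite mulr0 add0r.
move=> /(KaP _ _ _ B1G)[H [S [g [gE gP]]]]; exists H, S, g; split=> // e eU /=.
by have [-> <-] := gP e eU; rewrite mulr0 addr0.
Qed.
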